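(* Consider a sequence of experiments indexed by the sample size $n$ in which treatment is assigned by a Bernoulli randomization design for every $n$, or by complete randomization (with a fixed $p\in(0,1)$) for every $n$, and suppose the regularity conditions (Assumption R in the context) hold. If $d_{\mathrm{avg}}=O(1)$ (bounded interference), then the Horvitz–Thompson and Hájek estimators are root-$n$ consistent for $\tau_{EATE}$: $$\hat\tau_{HT}-\tau_{EATE}=O_p(n^{-1/2})\qquad\text{and}\qquad \hat\tau_{HA}-\tau_{EATE}=O_p(n^{-1/2}).$$
   Context: Setting. For each sample size $n$ there are units $U=\{1,\dots,n\}$ and arbitrary potential outcome functions $y_i:\{0,1\}^n\to\mathbb R$, $i\in U$. For $\mathbf z\in\{0,1\}^n$, $\mathbf z_{-i}\in\{0,1\}^{n-1}$ is $\mathbf z$ with its $i$th entry deleted, and $y_i(\mathbf z)$ is also written $y_i(z_i;\mathbf z_{-i})$. An experimental design is the probability distribution of a random vector $\mathbf Z=(Z_1,\dots,Z_n)\in\{0,1\}^n$; it is the only source of randomness. Write $Y_i=y_i(\mathbf Z)$ and $p_i=\Pr(Z_i=1)$. All objects depend on $n$, with no relation assumed between different $n$; asymptotics are as $n\to\infty$. Assumption R (regularity conditions). There are constants $k<\infty$, $q\ge 2$, $s\ge 1$ such that for all $n$ and all $i\in U$: $k^{-1}\le \Pr(Z_i=1)\le 1-k^{-1}$; $E[|Y_i|^q]\le k^q$; and $E[|y_i(z;\mathbf Z_{-i})|^s]\le k^s$ for $z\in\{0,1\}$. Bernoulli randomization design: $\Pr(\mathbf Z=\mathbf z)=\prod_{i=1}^n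 p_i^{z_i}(1-p_i)^{1-z_i}$. Complete randomization: for a fixed $p\in(0,1)$ and $m=\lfloor pn\rfloor$, $\Pr(\mathbf Z=\mathbf z)=\binom nm^{-1}$ if $\sum_i z_i=m$, and $0$ otherwise. Interference. $I_{ij}=1$ if $i=j$ or if $y_j(\mathbf z)\ne y_j(\mathbf z')$ for some $\mathbf z,\mathbf z'\in\{0,1\}^n$ with $\mathbf z_{-i}=\mathbf z'_{-i}$; otherwise $I_{ij}=0$. $d_{ij}=1$ if $I_{\ell i}I_{\ell j}=1$ for some $\ell\in U$, else $d_{ij}=0$; $d_{\mathrm{avg}}=n^{-1}\sum_{i=1}^n\sum_{j=1}^n d_{ij}$. Estimand: $\tau_{EATE}=n^{-1}\sum_{i=1}^n E[y_i(1;\mathbf Z_{-i})-y_i(0;\mathbf Z_{-i})]$, expectation over the (unconditional) design. Estimators: $\hat\tau_{HT}=\frac1n\sum_i \frac{Z_iY_i}{p_i}-\frac1n\sum_i\frac{(1-Z_i)Y_i}{1-p_i}$ and $\hat\tau_{HA}=\Big(\sum_i\frac{Z_iY_i}{p_i}\Big/\sum_i\frac{Z_i}{p_i}\Big)-\Big(\sum_i\frac{(1-Z_i)Y_i}{1-p_i}\Big/\sum_i\frac{1-Z_i}{1-p_i}\Big)$, where a ratio with zero denominator is assigned the value $0$. $X_n=O_p(a_n)$ means that for every $\varepsilon>0$ there is $M<\infty$ with $\Pr(|X_n|>M a_n)\le\varepsilon$ for all sufficiently large $n$. *)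

(* Defs.v *)
From HB Require Import structures.
From mathcomp Require Export all_boot all_order all_algebra.
From mathcomp Require Export all_classical all_reals all_analysis.

Set Implicit Arguments.
Unset Strict Implicit.
Unset Printing Implicit Defensive.

Import Order.TTheory GRing.Theory Num.Theory.
Export numFieldNormedType.Exports.

Local Open Scope classical_set_scope.
Local Open Scope ring_scope.

Definition assignment (n : nat) := {ffun 'I_n -> bool}.

(* The design is the only source of randomness, so the sample space is
   {0,1}^n itself, with the random vector Z as the identity on it. *)
Record design (R : realType) (n : nat) := Design {
  pmf :> assignment n -> R;
  pmf_ge0 : forall z, 0 <= pmf z;
  pmf_sum1 : \sum_z pmf z = 1
}.

Definition Pr (R : realType) n (P : design R n) (A : pred (assignment n)) : R :=
  \sum_(z | A z) P z.

Definition expect (R : realType) n (P : design R n) (f : assignment n -> R) : R :=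
  \sum_z P z * f z.

Definition prop_score (R : realType) n (P : design R n) (i : 'I_n) : R :=
  Pr P (fun z => z i).

Definition outcomes (R : realType) (n : nat) := 'I_n -> assignment n -> R.

(* z_{-i} : the vector z with its i-th entry deleted. *)
Definition del n (i : 'I_n) (z : assignment n) : assignment n.-1 :=
  [ffun j => z (lift i j)].

(* (b; w) : the vector with i-th entry b whose remaining entries are w. *)
Definition ins n (i : 'I_n) (b : bool) (w : assignment n.-1) : assignment n :=
  [ffun j => if unlift i j is Some j' then w j' else b].

Definition bernoulli_design (R : realType) n (P : design R n) : Prop :=
  forall z, P z =
    \prod_i (prop_score P i ^+ z i * (1 - prop_score P i) ^+ (1 - z i)%N).

Definition complete_design (R : realType) (p : R) n (P : design R n) : Prop :=
  let m := Num.truncn (p * n%:R) in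
  forall z, P z = if (\sum_i z i == m)%N then ('C(n, m)%:R)^-1 else 0.

(* The bounds required of an experiment with n units.  Positivity of k is
   implicit in the usual writing k^-1 <= p_i <= 1 - k^-1; it is explicit here
   because 0^-1 = 0 and powR is total. *)
Definition regular_at (R : realType) (k q s : R) n
    (y : outcomes R n) (P : design R n) : Prop :=
  forall i : 'I_n,
    [/\ k^-1 <= prop_score P i <= 1 - k^-1,
        expect P (fun z => `|y i z| `^ q) <= k `^ q
      & forall b : bool,
          expect P (fun z => `|y i (ins i b (del i z))| `^ s) <= k `^ s].

(* The same constants serve all sample sizes n >= n0. *)
Definition regularity_conditions (R : realType) (n0 : nat)
    (y : forall n, outcomes R n) (P : forall n, design R n) : Prop :=
  exists k q s : R,
    [/\ 0 < k, 2 <= q, 1 <= s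
      & forall n, (n0 <= n)%N -> regular_at k q s (y n) (P n)].

(* I_ij : unit i interferes with unit j. *)
Definition interferes (R : realType) n (y : outcomes R n) (i j : 'I_n) : bool :=
  (i == j) ||
  [exists z, exists z', (del i z == del i z') && (y j z != y j z')].

(* d_ij : units i and j are interference dependent. *)
Definition dependent (R : realType) n (y : outcomes R n) (i j : 'I_n) : bool :=
  [exists l, interferes y l i && interferes y l j].

Definition davg (R : realType) n (y : outcomes R n) : R :=
  n%:R^-1 * \sum_i \sum_j (dependent y i j)%:R.

Definition tau_EATE (R : realType) n (y : outcomes R n) (P : design R n) : R :=
  n%:R^-1 * \sum_i expect P (fun z =>
    y i (ins i true (del i z)) - y i (ins i false (del i z))).

Definition tau_HT (R : realType) n (y : outcomes R n) (P : design R n)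
    (z : assignment n) : R :=
  n%:R^-1 * \sum_i ((z i)%:R * y i z / prop_score P i)
  - n%:R^-1 * \sum_i ((1 - (z i)%:R) * y i z / (1 - prop_score P i)).

(* A ratio with zero denominator is 0, since x / 0 = 0 in a fieldType. *)
Definition tau_HA (R : realType) n (y : outcomes R n) (P : design R n)
    (z : assignment n) : R :=
  (\sum_i ((z i)%:R * y i z / prop_score P i))
    / (\sum_i ((z i)%:R / prop_score P i))
  - (\sum_i ((1 - (z i)%:R) * y i z / (1 - prop_score P i)))
    / (\sum_i ((1 - (z i)%:R) / (1 - prop_score P i))).

(* X_n = O_p(a_n) *)
Definition bigOp (R : realType) (P : forall n, design R n)
    (X : forall n, assignment n -> R) (a : nat -> R) : Prop :=
  forall eps : R, 0 < eps -> exists M : R,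
    \forall n \near \oo, Pr (P n) (fun z => M * a n < `|X n z|) <= eps.

(* Main.v *)
(* Up to a bias, each arm of the Horvitz-Thompson estimator is an average of n
   variables, the i-th depending only on the assignments of the units that
   interfere with i; write c_i for their number.  Both designs are weakly
   dependent: for disjoint blocks A and B of units the likelihood ratio of the
   joint law to the product of the marginals is 1 + O(|A||B|/n).  This is exact
   for Bernoulli; for complete randomization it follows from the
   hypergeometric formula.  Hence the covariance of terms i and j is O(1) if
   they are interference dependent and O(c_i c_j / n) otherwise; since
   sum_i c_i <= n d_avg, the variance of an arm is O(1/n).  The bias, which is
   the covariance of Z_i with the counterfactual outcome divided by p_i,
   averages to O(1/n) likewise.  The denominators of the Hajek ratios are the
   arms for constant outcome 1, so they are 1 + O_p(n^{-1/2}). *)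
Require Import Defs.
From mathcomp Require Import ring lra zify.
Import Order.TTheory GRing.Theory Num.Theory.
Import numFieldNormedType.Exports.
Local Open Scope ring_scope.
Set Implicit Arguments.
Unset Strict Implicit.

(** * Expectations and blocks of units *)

Section Expectation.
Variables (R : realType) (n : nat) (P : design R n).
Implicit Types (f g : assignment n -> R) (A B : {set 'I_n}).

Lemma eq_expect f g : f =1 g -> expect P f = expect P g.
Proof. by move=> fg; apply: eq_bigr => z _; rewrite fg. Qed.

Lemma expectD f g : expect P (fun z => f z + g z) = expect P f + expect P g.
Proof. by rewrite /expect -big_split /=; apply: eq_bigr => z _; rewrite mulrDr. Qed.

Lemma expectZ a f : expect P (fun z => a * f z) = a * expect P f.
Proof. by rewrite /expect mulr_sumr; apply: eq_bigr => z _; rewrite mulrCA. Qed.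

Lemma expectB f g : expect P (fun z => f z - g z) = expect P f - expect P g.
Proof. by rewrite /expect -sumrB; apply: eq_bigr => z _; rewrite mulrBr. Qed.

Lemma expect_cst a : expect P (fun=> a) = a.
Proof. by rewrite /expect -mulr_suml pmf_sum1 mul1r. Qed.

Lemma expect_sum (I : finType) (F : I -> assignment n -> R) :
  expect P (fun z => \sum_i F i z) = \sum_i expect P (F i).
Proof. by rewrite /expect exchange_big; apply: eq_bigr => z _; rewrite mulr_sumr. Qed.

Lemma le_expect f g : (forall z, f z <= g z) -> expect P f <= expect P g.
Proof. by move=> fg; apply: ler_sum => z _; rewrite ler_wpM2l ?pmf_ge0. Qed.

Lemma expect_ge0 f : (forall z, 0 <= f z) -> 0 <= expect P f.
Proof. by move=> f0; apply: sumr_ge0 => z _; rewrite mulr_ge0 ?pmf_ge0. Qed.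

Lemma expect_norm f : `|expect P f| <= expect P (fun z => `|f z|).
Proof.
apply: le_trans (ler_norm_sum _ _ _) _; apply: ler_sum => z _.
by rewrite normrM ger0_norm ?pmf_ge0.
Qed.

(** Pointwise [|f| <= 1 + f ^+ 2]; cruder than Cauchy-Schwarz, but it keeps every later constant
    polynomial in [K]. *)
Lemma expect_norm_le f K :
  expect P (fun z => f z ^+ 2) <= K -> expect P (fun z => `|f z|) <= 1 + K.
Proof.
move=> fK; apply: (@le_trans _ _ (expect P (fun z => 1 + f z ^+ 2))).
  apply: le_expect => z; rewrite -real_normK ?num_real//.
  by have := sqr_ge0 (`|f z| - 1); nra.
by rewrite expectD expect_cst lerD2l.
Qed.

Lemma PrE (E : pred (assignment n)) : Pr P E = expect P (fun z => (E z)%:R).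
Proof.
by rewrite /Pr big_mkcond; apply: eq_bigr => z _; case: (E z); rewrite ?mulr1 ?mulr0.
Qed.

Lemma le_Pr (E F : pred (assignment n)) : subpred E F -> Pr P E <= Pr P F.
Proof.
move=> EF; rewrite !PrE; apply: le_expect => z.
by case: (E z) (EF z) => // ->.
Qed.

Lemma le_PrU (E F : pred (assignment n)) :
  Pr P (fun z => E z || F z) <= Pr P E + Pr P F.
Proof.
rewrite !PrE -expectD; apply: le_expect => z.
by case: (E z); case: (F z); rewrite /= ?addr0 ?add0r// lerDl ler01.
Qed.

Lemma chebyshev (c : R) f : 0 < c ->
  Pr P (fun z => c < `|f z|) <= expect P (fun z => f z ^+ 2) / c ^+ 2.
Proof.
move=> c0; rewrite PrE mulrC -expectZ; apply: le_expect => z.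
case: ltP => [cf|_]; last by rewrite mulr_ge0 ?invr_ge0 ?sqr_ge0.
rewrite mulrC ler_pdivlMr ?exprn_gt0// mul1r -[leRHS]real_normK ?num_real//.
by rewrite lerXn2r// ?nnegrE ltW// (lt_trans c0).
Qed.

Lemma expect_sqrD f g :
  expect P (fun z => (f z + g z) ^+ 2) <=
  2 * expect P (fun z => f z ^+ 2) + 2 * expect P (fun z => g z ^+ 2).
Proof.
rewrite -!expectZ -expectD; apply: le_expect => z.
by have := sqr_ge0 (f z - g z); nra.
Qed.

Definition depends_on A f :=
  forall z z' : assignment n, {in A, z =1 z'} -> f z = f z'.

(** Zeroing the entries outside the block keeps configurations of all blocks in one type; those of
    [A] are the fixed points of [restr A], and every other vector has marginal mass 0. *)
Definition restr A (z : assignment n) : assignment n :=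
  [ffun i => (i \in A) && z i].

Lemma depends_on_restr A f z : depends_on A f -> f (restr A z) = f z.
Proof. by apply=> i iA; rewrite ffunE iA. Qed.

Definition marginal A u : R := Pr P (fun z => restr A z == u).

Definition joint A B u v : R :=
  Pr P (fun z => (restr A z == u) && (restr B z == v)).

Lemma expect_marginal A f : depends_on A f ->
  expect P f = \sum_u marginal A u * f u.
Proof.
move=> fA; rewrite /expect (partition_big (restr A) predT)//=.
apply: eq_bigr => u _; rewrite /marginal /Pr mulr_suml.
by apply: eq_bigr => z /eqP <-; rewrite (depends_on_restr _ fA).
Qed.

Lemma expect_joint A B f g : depends_on A f -> depends_on B g ->
  expect P (fun z => f z * g z) = \sum_u \sum_v joint A B u v * (f u * g v).
Proof.
move=> fA gB; rewrite /expect (partition_big (restr A) predT)//=.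
apply: eq_bigr => u _; rewrite (partition_big (restr B) predT)//=.
apply: eq_bigr => v _; rewrite /joint /Pr mulr_suml.
by apply: eq_bigr => z /andP[/eqP <- /eqP <-]; rewrite !depends_on_restr.
Qed.

(** The form in which a likelihood ratio within [e] of 1 is used: the error is relative to first
    absolute moments, so unbounded outcomes are allowed. *)
Definition nearly_independent A B (e : R) := forall f g,
  depends_on A f -> depends_on B g ->
  `|expect P (fun z => f z * g z) - expect P f * expect P g| <=
    e * (expect P (fun z => `|f z|) * expect P (fun z => `|g z|)).

Lemma marginal_eq0 A u : u != restr A u -> marginal A u = 0.
Proof.
move=> uA; rewrite /marginal /Pr big_pred0// => z; apply: contraNF uA => /eqP <-.
by apply/eqP/ffunP => i; rewrite !ffunE; case: (i \in A).
Qed.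

(** Both expectations are sums over pairs of block configurations, so the triangle inequality
    applies term by term. Pairs that are not genuine configurations have mass 0 on both sides. *)
Lemma nearly_independent_atoms A B e :
  (forall u v, u = restr A u -> v = restr B v ->
   `|joint A B u v - marginal A u * marginal B v| <=
     e * (marginal A u * marginal B v)) ->
  nearly_independent A B e.
Proof.
move=> H f g fA gB.
have nA h C : depends_on C h -> depends_on C (fun z => `|h z|).
  by move=> hC z z' zz'; rewrite (hC _ _ zz').
rewrite (expect_joint fA gB) (expect_marginal fA) (expect_marginal gB).
rewrite (expect_marginal (nA _ _ fA)) (expect_marginal (nA _ _ gB)).
rewrite !mulr_suml mulr_sumr -sumrB; apply: le_trans (ler_norm_sum _ _ _) _.
apply: ler_sum => u _; rewrite !mulr_sumr -sumrB.
apply: le_trans (ler_norm_sum _ _ _) _; apply: ler_sum => v _.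
have -> : joint A B u v * (f u * g v) - marginal A u * f u * (marginal B v * g v)
  = (joint A B u v - marginal A u * marginal B v) * (f u * g v) by ring.
have -> : e * (marginal A u * `|f u| * (marginal B v * `|g v|)) =
  e * (marginal A u * marginal B v) * (`|f u| * `|g v|) by ring.
rewrite !normrM ler_wpM2r ?mulr_ge0//.
have j0 C u' (F : pred _) : u' != restr C u' ->
   Pr P (fun z => (restr C z == u') && F z) = 0.
  move=> uC; apply/le_anti/andP; split; last by rewrite PrE expect_ge0.
  by rewrite -(marginal_eq0 uC); apply: le_Pr => z /andP[].
have [/eqP uA|uA] := boolP (u == restr A u); last first.
  by rewrite (marginal_eq0 uA) /joint j0// !(mul0r, mulr0) subrr normr0.
have [/eqP vB|vB] := boolP (v == restr B v); last first.
  rewrite (marginal_eq0 vB) /joint.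
  under [Pr P _]eq_bigl => z do rewrite andbC.
  by rewrite [X in X - _]j0// !(mul0r, mulr0) subrr normr0.
exact: H.
Qed.

End Expectation.

Lemma restr_eqP n (A : {set 'I_n}) (z u : assignment n) : u = restr A u ->
  (restr A z == u) = [forall i in A, z i == u i].
Proof.
move=> uA; apply/eqP/forall_inP => [<- i iA|zu]; first by rewrite ffunE iA.
apply/ffunP => i; rewrite uA !ffunE; case: (boolP (i \in A)) => //= iA.
exact/eqP/zu.
Qed.

(** * Independence of blocks under Bernoulli randomization *)

Section Bernoulli.
Variables (R : realType) (n : nat) (P : design R n).
Hypothesis bernP : bernoulli_design P.

(** A sum over a product event of a product of coordinate weights distributes into a product of
    coordinate sums. *)
Lemma bernoulli_Pr (S : 'I_n -> pred bool) (E : pred (assignment n)) :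
  (forall z, E z = [forall i, S i (z i)]) ->
  Pr P E = \prod_i \sum_(b | S i b)
    prop_score P i ^+ b * (1 - prop_score P i) ^+ (1 - b)%N.
Proof.
move=> ES; under [RHS]eq_bigr do rewrite big_mkcond/=.
rewrite bigA_distr_bigA /Pr big_mkcond/=; apply: eq_bigr => z _.
rewrite ES bernP; case: forallP => [H|].
  by apply: eq_bigr => i _; rewrite H.
move/forallP; rewrite negb_forall => /existsP[i /negbTE Si].
by rewrite (bigD1 i)//= Si mul0r.
Qed.

(** Prescribing the configuration of a block is a product event. At each coordinate at least one of
    two disjoint blocks imposes nothing and contributes the total mass 1, so the joint law factors
    exactly. *)
Lemma bernoulli_nearly_independent (A B : {set 'I_n}) : [disjoint A & B] ->
  nearly_independent P A B 0.
Proof.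
move=> AB; apply: nearly_independent_atoms => u v uA vB.
rewrite mul0r normr_le0 subr_eq0; apply/eqP.
pose S (C : {set 'I_n}) (w : assignment n) i b := (i \in C) ==> (b == w i).
have mE C w : w = restr C w -> forall z : assignment n,
    (restr C z == w) = [forall i, S C w i (z i)].
  by move=> wC z; rewrite restr_eqP.
have jE (z : assignment n) : (restr A z == u) && (restr B z == v) =
    [forall i, S A u i (z i) && S B v i (z i)].
  rewrite (mE _ _ uA) (mE _ _ vB).
  apply/andP/forallP => [[/forallP zu /forallP zv] i|H]; first by rewrite zu zv.
  by split; apply/forallP => i; case/andP: (H i).
rewrite /marginal (bernoulli_Pr (S := S A u) (mE _ _ uA)).
rewrite (bernoulli_Pr (S := S B v) (mE _ _ vB)).
rewrite /joint (bernoulli_Pr (S := fun i b => S A u i b && S B v i b) jE).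
rewrite -big_split/=; apply: eq_bigr => i _.
have sum1 : \sum_(b : bool) prop_score P i ^+ b * (1 - prop_score P i) ^+ (1 - b)%N = 1.
  by rewrite big_bool/= expr1 expr0 expr0 expr1; ring.
rewrite /S; have [iA|iA] /= := boolP (i \in A).
  by rewrite (disjointFr AB iA)/= sum1 mulr1; under eq_bigl do rewrite andbT.
by rewrite sum1 mul1r.
Qed.

End Bernoulli.

(** * Ratios of factorials *)

Section FactorialRatio.
Variable R : realType.

(* The hypergeometric likelihood ratio of two disjoint blocks is a quotient of
   three such factors, each equal to [\prod_(j < y) (1 - x / (N - j))]. *)
Definition fact_ratio (N x y : nat) : R :=
  (N - x)`!%:R * (N - y)`!%:R / ((N - x - y)`!%:R * N`!%:R).

(** Passing from [y] to [y.+1] multiplies the ratio by [1 - x / (N - y)]. Since [N - y >= H] and the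
    ratio is at most 1, each step loses at most [x / H]. *)
Lemma fact_ratio_bounds (H : R) N x y : 0 < H -> (x + y <= N)%N ->
  H + y%:R <= N%:R -> 1 - (x * y)%:R / H <= fact_ratio N x y <= 1.
Proof.
have f0 k : k`!%:R != 0 :> R by rewrite pnatr_eq0 -lt0n fact_gt0.
move=> H0; elim: y => [|y IH] xyN HN.
  by rewrite muln0 mul0r subr0 /fact_ratio !subn0 divff ?lexx ?mulf_neq0.
have Hy : H + y%:R <= N%:R by apply: le_trans HN; rewrite lerD2l ler_nat.
have /andP[l u] := IH ltac:(lia) Hy.
have NyE : (N - y)%:R = N%:R - y%:R :> R by rewrite natrB//; lia.
have Ny0 : 0 < (N - y)%:R :> R by rewrite ltr0n; lia.
have -> : fact_ratio N x y.+1 = fact_ratio N x y * (1 - x%:R / (N - y)%:R).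
  rewrite /fact_ratio.
  have -> : (N - y = (N - y.+1).+1)%N by lia.
  have -> : (N - x - y = (N - x - y.+1).+1)%N by lia.
  rewrite !factS !natrM.
  have -> : x%:R = (N - y.+1).+1%:R - (N - x - y.+1).+1%:R :> R.
    by rewrite -natrB; [congr (_%:R); lia|lia].
  field; rewrite !f0 ?andbT/=.
  by rewrite -!(natrD _ 1) !pnatr_eq0.
have x1 : x%:R / (N - y)%:R <= 1 :> R.
  by rewrite ler_pdivrMr// mul1r ler_nat; lia.
have x0 : 0 <= x%:R / (N - y)%:R :> R by rewrite divr_ge0.
have xH : x%:R / (N - y)%:R <= x%:R / H.
  rewrite ler_wpM2l// lef_pV2 ?posrE// NyE; lra.
have r0 : 0 <= fact_ratio N x y by rewrite !(mulr_ge0, invr_ge0).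
rewrite mulnS natrD mulrDl; apply/andP; split; nra.
Qed.

End FactorialRatio.

(** * Complete randomization *)

Section Complete.
Variables (R : realType) (n m : nat) (P : design R n).
Hypothesis compP :
  forall z, P z = if (\sum_i z i == m)%N then ('C(n, m)%:R)^-1 else 0.

Definition treated (z : assignment n) : {set 'I_n} := [set i | z i].

Lemma card_treated (z : assignment n) : (\sum_i z i)%N = #|treated z|.
Proof.
rewrite -sum1_card [RHS]big_mkcond/=; apply: eq_bigr => i _.
by rewrite inE; case: (z i).
Qed.

Lemma treated_restr (A : {set 'I_n}) u : u = restr A u -> treated u \subset A.
Proof. by move=> ->; apply/fintype.subsetP => i; rewrite inE ffunE => /andP[]. Qed.

(** By counting: an assignment with [m] treated units extending [u] amounts to a choice of the
    remaining [m - #|treated u|] treated units outside [A]. *)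
Lemma complete_marginal (A : {set 'I_n}) u : u = restr A u ->
  (#|treated u| <= m)%N ->
  marginal P A u = 'C(n - #|A|, m - #|treated u|)%:R / 'C(n, m)%:R.
Proof.
move=> uA um; pose D := [set S : {set 'I_n} |
  (S \subset ~: A) && (#|S| == (m - #|treated u|)%N)].
pose ext (S : {set 'I_n}) : assignment n := [ffun i => (i \in S) || u i].
have uoff i : i \notin A -> u i = false.
  by move=> /negbTE iA; rewrite uA ffunE iA.
have extD S : S \in D -> treated (ext S) :\: A = S.
  rewrite inE => /andP[/fintype.subsetP SA _]; apply/setP => i; rewrite !inE ffunE.
  case: (boolP (i \in A)) => /= iA; last by rewrite uoff ?orbF.
  by apply/esym/negbTE; apply: contraL iA => /SA; rewrite inE.
have <- : #|D| = 'C(n - #|A|, m - #|treated u|).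
  rewrite cards_draws; congr 'C(_, _).
  by have := cardsC A; rewrite card_ord; lia.
rewrite -(card_in_imset (f := ext) (D := D)); last first.
  by move=> S S' /extD SE /extD SE' e; rewrite -SE -SE' e.
have -> : [set ext S | S in D] =
    [set z | (restr A z == u) && (#|treated z| == m)].
  apply/setP => z; rewrite inE; apply/imsetP/andP.
  - case=> S SD ->.
    have SE := extD _ SD; move: SD; rewrite inE => /andP[SA /eqP Sm].
    have rE : restr A (ext S) = u.
      apply/ffunP => i; rewrite !ffunE; case: (boolP (i \in A)) => /= iA.
        case: (boolP (i \in S)) => //= iS.
        by move: (fintype.subsetP SA _ iS); rewrite inE iA.
      by rewrite uoff.
    split; first exact/eqP.
    rewrite -(cardsID A (treated (ext S))) SE Sm.
    have -> : treated (ext S) :&: A = treated u.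
      by apply/setP => i; rewrite !inE -rE !ffunE andbC.
    by rewrite subnKC.
  - case=> /eqP zu /eqP zm; exists (treated z :\: A).
      rewrite inE subsetDr/= cardsD zm.
      suff -> : treated z :&: A = treated u by [].
      by apply/setP => i; rewrite !inE -zu ffunE andbC.
    apply/ffunP => i; rewrite ffunE !inE -zu ffunE.
    by case: (i \in A); case: (z i).
rewrite /marginal /Pr.
under eq_bigr do rewrite compP card_treated.
rewrite -big_mkcondr/= sumr_const mulr_natl; congr (_ *+ _).
by apply: eq_card => z; rewrite !inE.
Qed.

Definition glue (u v : assignment n) : assignment n := [ffun i => u i || v i].

(** Brings the joint law under the closed form for marginals, since a pair of configurations on
    disjoint blocks is one configuration on their union. *)
Lemma joint_glue (A B : {set 'I_n}) u v : [disjoint A & B] ->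
  u = restr A u -> v = restr B v ->
  joint P A B u v = marginal P (A :|: B) (glue u v).
Proof.
move=> AB uA vB; apply: eq_bigl => z; apply/andP/eqP => [[/eqP <- /eqP <-]|zuv].
  by apply/ffunP => i; rewrite !ffunE inE andb_orl.
have zi i : (i \in A :|: B) && z i = u i || v i.
  by have := congr1 (fun w : assignment n => w i) zuv; rewrite !ffunE.
have uE i : u i = (i \in A) && u i by rewrite {1}uA ffunE.
have vE i : v i = (i \in B) && v i by rewrite {1}vB ffunE.
split; apply/eqP/ffunP => i; rewrite ffunE; have := zi i; rewrite uE vE inE.
- case: (boolP (i \in A)) => //= iA ->.
  by rewrite (disjointFr AB iA) /= orbF.
- case: (boolP (i \in B)) => //= iB; rewrite orbT/= => ->.
  by rewrite (disjointFl AB iB).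
Qed.

Lemma bin_factR (N M : nat) : (M <= N)%N ->
  'C(N, M)%:R = N`!%:R / (M`!%:R * (N - M)`!%:R) :> R.
Proof.
move=> MN; rewrite -(bin_fact MN) 2!natrM mulfK//.
Qed.

(** The likelihood ratio with its denominator cleared. Once binomials are written with factorials
    all else cancels, leaving one factor for all units, one for the treated and one for the
    controls. The size conditions make the natural-number subtractions exact. *)
Lemma complete_likelihood_ratio (A B : {set 'I_n}) u v : [disjoint A & B] ->
  u = restr A u -> v = restr B v ->
  (m <= n)%N -> (#|A| + #|B| <= m)%N -> (#|A| + #|B| <= n - m)%N ->
  joint P A B u v * fact_ratio R n #|A| #|B| =
  fact_ratio R m #|treated u| #|treated v| *
  fact_ratio R (n - m) (#|A| - #|treated u|) (#|B| - #|treated v|) *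
  (marginal P A u * marginal P B v).
Proof.
move=> AB uA vB mn ABm ABn.
have tA := subset_leq_card (treated_restr uA).
have sB := subset_leq_card (treated_restr vB).
have uvE : treated (glue u v) = treated u :|: treated v.
  by apply/setP => i; rewrite !inE ffunE.
have dis : [disjoint treated u & treated v].
  by apply: disjointWl (treated_restr uA) (disjointWr (treated_restr vB) AB).
have cuv : #|treated (glue u v)| = (#|treated u| + #|treated v|)%N.
  by rewrite uvE cardsU (disjoint_setI0 dis) cards0 subn0.
have cAB : #|A :|: B| = (#|A| + #|B|)%N by rewrite cardsU (disjoint_setI0 AB) cards0 subn0.
have uvR : glue u v = restr (A :|: B) (glue u v).
  apply/ffunP => i; rewrite !ffunE inE uA vB !ffunE.
  by case: (i \in A); case: (i \in B); case: (u i); case: (v i).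
rewrite joint_glue// (complete_marginal uvR) ?cuv; last lia.
rewrite (complete_marginal uA) ?(complete_marginal vB); try lia.
rewrite cAB.
move: #|A| #|B| #|treated u| #|treated v| tA sB ABm ABn => a b t s ta sb abm abn.
rewrite /fact_ratio !bin_factR; try lia.
have -> : (n - (a + b) - (m - (t + s)) = n - m - (a - t) - (b - s))%N by lia.
have -> : (n - a - (m - t) = n - m - (a - t))%N by lia.
have -> : (n - b - (m - s) = n - m - (b - s))%N by lia.
rewrite !subnDA.
have f0 k : k`!%:R != 0 :> R by rewrite pnatr_eq0 -lt0n fact_gt0.
by field; rewrite !f0.
Qed.

(** The three factors lie in [[1 - e, 1]] with [e = 2 * k * c / n], so the likelihood ratio lies
    between [(1 - e) ^+ 2] and [1 / (1 - e)]. For [e <= 1/2] this is within [2 * e] of 1. *)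
Lemma complete_nearly_independent (A B : {set 'I_n}) (k c : R) :
  [disjoint A & B] -> 1 <= k -> (0 < n)%N ->
  n%:R / k <= m%:R -> m%:R <= (1 - k^-1) * n%:R ->
  #|A|%:R <= c -> #|B|%:R <= c -> (#|A| * #|B|)%:R <= c -> 4 * k * c <= n%:R ->
  nearly_independent P A B (4 * k * c / n%:R).
Proof.
move=> AB k1 n0 km mk Ac Bc ABc cn.
have nR : 0 < n%:R :> R by rewrite ltr0n.
have k0 : 0 < k by lra.
(* Treated and control units each number at least [n / k = 2 * H]. One [H] absorbs the block sizes,
   the other is the denominator in [fact_ratio_bounds]. *)
pose H : R := n%:R / (2 * k).
have H0 : 0 < H by rewrite divr_gt0// mulr_gt0.
have HE : n%:R / k = 2 * H by rewrite /H; field; lra.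
have mkE : (1 - k^-1) * n%:R = n%:R - 2 * H by rewrite /H; field; lra.
have cH : 2 * c <= H by rewrite /H ler_pdivlMr ?mulr_gt0//; lra.
rewrite HE in km; rewrite mkE in mk.
have nmR : (m <= n)%N by rewrite -(ler_nat R); lra.
have nmE : (n - m)%:R = n%:R - m%:R :> R by rewrite natrB.
have nH : 2 * H <= n%:R by lra.
have nmH : 2 * H <= (n - m)%:R by lra.
have ABm : (#|A| + #|B| <= m)%N by rewrite -(ler_nat R) natrD; lra.
have ABn : (#|A| + #|B| <= n - m)%N by rewrite -(ler_nat R) natrD nmE; lra.
apply: nearly_independent_atoms => u v uA vB.
have := complete_likelihood_ratio AB uA vB nmR ABm ABn.
have tA := subset_leq_card (treated_restr uA).
have sB := subset_leq_card (treated_restr vB).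
pose e := c / H.
have -> : 4 * k * c / n%:R = 2 * e by rewrite /e /H; field; lra.
have e2 : e <= 2^-1 by rewrite /e ler_pdivrMr//; lra.
have ratio N x y : (x <= #|A|)%N -> (y <= #|B|)%N -> (x + y <= N)%N ->
    2 * H <= N%:R -> 1 - e <= fact_ratio R N x y <= 1.
  move=> xA yB xyN HN.
  have yc : y%:R <= #|B|%:R :> R by rewrite ler_nat.
  have /andP[l ->] := @fact_ratio_bounds R H N x y H0 xyN ltac:(lra).
  rewrite andbT; apply: le_trans l; rewrite lerD2l lerN2.
  rewrite ler_wpM2r ?invr_ge0 ?(ltW H0)//; apply: le_trans ABc.
  by rewrite ler_nat leq_mul.
have /andP[] := ratio n #|A| #|B| (leqnn _) (leqnn _) (leq_trans ABm nmR) nH.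
have /andP[] := ratio m #|treated u| #|treated v| tA sB
  (leq_trans (leq_add tA sB) ABm) km.
have /andP[] := ratio (n - m)%N (#|A| - #|treated u|)%N (#|B| - #|treated v|)%N
  (leq_subr _ _) (leq_subr _ _)
  (leq_trans (leq_add (leq_subr _ _) (leq_subr _ _)) ABn) nmH.
have Pr0 E : 0 <= Pr P E by rewrite PrE expect_ge0.
have : 0 <= marginal P A u * marginal P B v by rewrite mulr_ge0 ?Pr0.
have : 0 <= joint P A B u v by exact: Pr0.
have e0 : 0 <= e by rewrite divr_ge0 ?(ltW H0)//; apply: le_trans Ac.
move: (fact_ratio _ n _ _) (fact_ratio _ m _ _) (fact_ratio _ (n - m) _ _).
move: (joint _ _ _ _ _) (_ * marginal _ _ _) => J W z x y J0 W0 y1 y2 x1 x2 z1 z2 E.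
clear - e0 e2 J0 W0 y1 y2 x1 x2 z1 z2 E.
have xy1 : x * y <= 1 by nra.
have xy2 : (1 - e) ^+ 2 <= x * y by rewrite expr2; nra.
have xyW1 : x * y * W <= W by nra.
have xyW2 : (1 - e) ^+ 2 * W <= x * y * W by nra.
have Jz1 : J * z <= J by nra.
have Jz2 : J * (1 - e) <= J * z by nra.
have We : 0 <= e ^+ 2 * W by rewrite mulr_ge0 ?sqr_ge0.
rewrite ler_norml; apply/andP; split; first by nra.
(* As [(1 + 2 * e) * (1 - e) = 1 + e * (1 - 2 * e) >= 1], this yields [J <= (1 + 2 * e) * W]. *)
have h1 : (1 + 2 * e) * (J * (1 - e)) <= (1 + 2 * e) * W.
  by apply: ler_wpM2l; lra.
have h2 : 0 <= J * (e * (1 - 2 * e)).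
  by apply: mulr_ge0 => //; apply: mulr_ge0 => //; lra.
nra.
Qed.

End Complete.

(** * Weakly dependent designs *)

Section WeakDependence.
Variables (R : realType) (n : nat) (P : design R n).
Hypothesis n0 : (0 < n)%N.

(* The bound [c] dominates the block sizes, not just their product, so that
   an empty block leaves room for the size of the other one. *)
Definition weakly_dependent (k : R) := forall (A B : {set 'I_n}) (c : R),
  [disjoint A & B] -> #|A|%:R <= c -> #|B|%:R <= c -> (#|A| * #|B|)%:R <= c ->
  4 * k * c <= n%:R -> nearly_independent P A B (4 * k * c / n%:R).

Definition positivity (k : R) :=
  forall i, k^-1 <= prop_score P i <= 1 - k^-1.

Let nR : 0 < n%:R :> R. Proof. by rewrite ltr0n. Qed.

Lemma bernoulli_weakly_dependent (k : R) : 0 < k -> bernoulli_design P ->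
  weakly_dependent k.
Proof.
move=> k0 bern A B c AB Ac Bc ABc _ f g fA gB.
apply: le_trans (bernoulli_nearly_independent bern AB fA gB) _.
rewrite mul0r mulr_ge0 ?divr_ge0 ?mulr_ge0 ?expect_ge0 ?(ltW k0)//.
exact: le_trans Ac.
Qed.

Lemma complete_weakly_dependent (k p : R) : 1 <= k -> positivity k ->
  complete_design p P -> weakly_dependent k.
Proof.
move=> k1 pos comp A B c AB Ac Bc ABc cn.
have {comp}[m comp] : exists m, forall z, P z =
    if (\sum_i z i == m)%N then ('C(n, m)%:R)^-1 else 0
  by exists (Num.truncn (p * n%:R)).
(* The expected number of treated units is [m], so summing the positivity bounds puts [m] between
   [n / k] and [(1 - k^-1) * n]. *)
have sum_p : \sum_i prop_score P i = m%:R.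
  under eq_bigr do rewrite /prop_score PrE.
  rewrite -expect_sum -[RHS](expect_cst P); apply: eq_bigr => z _.
  rewrite comp; case: eqP => [zm|_]; last by rewrite !mul0r.
  by rewrite -natr_sum zm.
apply: (complete_nearly_independent comp) => //.
- rewrite -sum_p mulrC; apply: le_trans (_ : \sum_(i < n) k^-1 <= _).
    by rewrite sumr_const card_ord mulr_natr.
  by apply: ler_sum => i _; have /andP[] := pos i.
- rewrite -sum_p; apply: (@le_trans _ _ (\sum_(i < n) (1 - k^-1))).
    by apply: ler_sum => i _; have /andP[] := pos i.
  by rewrite sumr_const card_ord mulr_natr.
Qed.

Variable k : R.
Hypotheses (k0 : 0 < k) (Pk : weakly_dependent k).

(** Removes the condition [4 * k * c <= n] from weak dependence at the price of the moment [M] of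
    the product. *)
Lemma covariance_bound (A B : {set 'I_n}) f g (c L L' M : R) :
  [disjoint A & B] -> #|A|%:R <= c -> #|B|%:R <= c -> (#|A| * #|B|)%:R <= c ->
  depends_on A f -> depends_on B g ->
  expect P (fun z => `|f z|) <= L -> expect P (fun z => `|g z|) <= L' ->
  expect P (fun z => `|f z * g z|) <= M ->
  `|expect P (fun z => f z * g z) - expect P f * expect P g| <=
    4 * k * c / n%:R * (M + L * L').
Proof.
move=> AB Ac Bc ABc fA gB fL gL fgM.
have f0 : 0 <= expect P (fun z => `|f z|) by apply: expect_ge0.
have g0 : 0 <= expect P (fun z => `|g z|) by apply: expect_ge0.
have M0 : 0 <= M by apply: le_trans fgM; apply: expect_ge0.
have fgL : expect P (fun z => `|f z|) * expect P (fun z => `|g z|) <= L * L'.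
  by apply: ler_pM.
have c0 : 0 <= c by apply: le_trans Ac.
(* Blocks with [4 k c > n] are handled by the trivial bound [M + L L']. *)
have [cn|cn] := leP (4 * k * c) n%:R.
  apply: le_trans (Pk AB Ac Bc ABc cn fA gB) _.
  rewrite ler_wpM2l ?divr_ge0 ?mulr_ge0 ?(ltW k0)//.
  by apply: le_trans fgL _; rewrite lerDr.
apply: (@le_trans _ _ (M + L * L')).
  apply: le_trans (ler_normB _ _) _; apply: lerD.
    exact: le_trans (expect_norm _ _) fgM.
  by rewrite normrM; apply: le_trans fgL; rewrite ler_pM ?expect_norm.
rewrite ler_peMl ?addr_ge0//; first by apply: le_trans fgL; rewrite mulr_ge0.
by rewrite ler_pdivlMr// mul1r ltW.
Qed.

Lemma expect_norm_mul_le (f g : assignment n -> R) K :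
  expect P (fun z => f z ^+ 2) <= K -> expect P (fun z => g z ^+ 2) <= K ->
  expect P (fun z => `|f z * g z|) <= K.
Proof.
move=> fK gK.
apply: (@le_trans _ _ (2^-1 * expect P (fun z => f z ^+ 2 + g z ^+ 2))); last first.
  by rewrite expectD; lra.
rewrite -expectZ; apply: le_expect => z; rewrite normrM.
rewrite -[f z ^+ 2]real_normK ?num_real// -[g z ^+ 2]real_normK ?num_real//.
by have := sqr_ge0 (`|f z| - `|g z|); lra.
Qed.

(** The first factor bounds one covariance. In the second, [D] accounts for the pairs with
    overlapping blocks and [4 * k * D ^+ 2] for the disjoint pairs. *)
Definition variance_rate (K D : R) := (K + (1 + K) * (1 + K)) * (D + 4 * k * D ^+ 2).

(** The variance is [n^-2] times a double sum of covariances. At most [D * n] pairs overlap, each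
    contributing O(1); the disjoint pairs contribute in total a multiple of
    [(\sum_i #|S i|) ^+ 2 / n], which is O(n). *)
Lemma mean_square_average (X : 'I_n -> assignment n -> R)
    (S : 'I_n -> {set 'I_n}) (K D : R) :
  (forall i, i \in S i) -> (forall i, depends_on (S i) (X i)) ->
  (forall i, expect P (fun z => X i z ^+ 2) <= K) ->
  \sum_i \sum_j (~~ [disjoint S i & S j])%:R <= D * n%:R ->
  expect P (fun z => (n%:R^-1 * \sum_i X i z - n%:R^-1 * \sum_i expect P (X i)) ^+ 2)
    <= variance_rate K D / n%:R.
Proof.
move=> Si SX XK SD; pose mu i := expect P (X i).
pose Q := K + (1 + K) * (1 + K).
have K0 : 0 <= K.
  by apply: le_trans (XK (Ordinal n0)); apply: expect_ge0 => z; apply: sqr_ge0.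
have Q0 : 0 <= Q by rewrite /Q; nra.
have S1 i : (1 <= #|S i|)%N by rewrite card_gt0; apply/set0Pn; exists i.
have covE i j : expect P (fun z => (X i z - mu i) * (X j z - mu j)) =
    expect P (fun z => X i z * X j z) - mu i * mu j.
  transitivity (expect P (fun z => X i z * X j z -
      (mu j * X i z + (mu i * X j z - mu i * mu j)))).
    by apply: eq_expect => z; ring.
  rewrite expectB expectD expectB !expectZ expect_cst -/(mu i) -/(mu j); ring.
have cov i j : expect P (fun z => (X i z - mu i) * (X j z - mu j)) <=
    Q * ((~~ [disjoint S i & S j])%:R + 4 * k * (#|S i|%:R * #|S j|%:R) / n%:R).
  rewrite covE; apply: le_trans (ler_norm _) _.
  have [dis|_] := boolP [disjoint S i & S j].
    (* Both blocks are nonempty, so the product of their sizes dominates each size and can serve as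
       [c]. *)
    rewrite add0r [leRHS]mulrC -natrM; apply: covariance_bound dis _ _ _ (SX i) (SX j) _ _ _.
    - by rewrite ler_nat leq_pmulr.
    - by rewrite ler_nat leq_pmull.
    - by [].
    - exact: expect_norm_le.
    - exact: expect_norm_le.
    - exact: expect_norm_mul_le.
  apply: (@le_trans _ _ Q); last first.
    by rewrite ler_peMr// lerDl divr_ge0// !mulr_ge0 ?(ltW k0).
  apply: le_trans (ler_normB _ _) _; apply: lerD.
    by apply: le_trans (expect_norm _ _) _; exact: expect_norm_mul_le.
  rewrite normrM; apply: ler_pM => //.
    by apply: le_trans (expect_norm _ _) _; exact: expect_norm_le.
  by apply: le_trans (expect_norm _ _) _; exact: expect_norm_le.
(* If [j] lies in [S i], the blocks of [i] and [j] share [j]; hence block sizes are bounded by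
   overlap counts. *)
have sumS : \sum_i #|S i|%:R <= D * n%:R.
  apply: le_trans SD; apply: ler_sum => i _.
  rewrite -sum1_card natr_sum big_mkcond/=; apply: ler_sum => j _.
  case: ifPn => // jS; suff -> : ~~ [disjoint S i & S j] by [].
  by rewrite -setI_eq0; apply/set0Pn; exists j; rewrite inE jS Si.
have sumS0 : 0 <= \sum_i #|S i|%:R :> R by apply: sumr_ge0.
have -> : expect P (fun z => (n%:R^-1 * \sum_i X i z - n%:R^-1 * \sum_i mu i) ^+ 2)
    = n%:R^-1 ^+ 2 * \sum_i \sum_j expect P (fun z => (X i z - mu i) * (X j z - mu j)).
  under [in RHS]eq_bigr do rewrite -expect_sum.
  rewrite -[in RHS]expect_sum -[RHS]expectZ; apply: eq_expect => z.
  rewrite -mulrBr exprMn -sumrB expr2 [X in _ * X = _]mulr_suml.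
  by congr (_ * _); apply: eq_bigr => i _; rewrite mulr_sumr.
apply: (@le_trans _ _ (n%:R^-1 ^+ 2 * (Q * (D * n%:R + 4 * k * (D * n%:R) ^+ 2 / n%:R)))).
  rewrite ler_wpM2l ?sqr_ge0//.
  apply: le_trans (ler_sum _ (fun i _ => ler_sum _ (fun j _ => cov i j))) _.
  under eq_bigr do rewrite -mulr_sumr big_split/=.
  rewrite -mulr_sumr big_split/=; apply: ler_wpM2l => //; apply: lerD => //.
  under eq_bigr do rewrite -mulr_suml -!mulr_sumr.
  rewrite -mulr_suml -mulr_sumr -mulr_suml.
  rewrite ler_wpM2r ?invr_ge0 ?(ltW nR)// ler_wpM2l ?mulr_ge0 ?(ltW k0)//.
  by rewrite expr2; apply: ler_pM.
rewrite /variance_rate -/Q le_eqVlt; apply/orP; left; apply/eqP.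
by field; rewrite gt_eqF.
Qed.

End WeakDependence.

(** * Interference and the two arms *)

Section Interference.
Variables (R : realType) (n : nat).
Implicit Types (y : outcomes R n) (P : design R n).

Lemma del_eqP (i : 'I_n) (z z' : assignment n) :
  (forall j, j != i -> z j = z' j) -> del i z = del i z'.
Proof. by move=> zz'; apply/ffunP => j; rewrite !ffunE zz'// eq_sym neq_lift. Qed.

Lemma ins_delE (i : 'I_n) b (z : assignment n) j :
  ins i b (del i z) j = if j == i then b else z j.
Proof.
rewrite ffunE; case: unliftP => [j' ->|->]; last by rewrite eqxx.
by rewrite ffunE eq_sym (negbTE (neq_lift _ _)).
Qed.

Lemma ins_delK (i : 'I_n) (z : assignment n) : ins i (z i) (del i z) = z.
Proof. by apply/ffunP => j; rewrite ins_delE; case: eqP => [->|]. Qed.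

Definition interferers y (j : 'I_n) : {set 'I_n} := [set l | interferes y l j].

Lemma mem_interferers y i : i \in interferers y i.
Proof. by rewrite inE /interferes eqxx. Qed.

Lemma dependentE y i j :
  dependent y i j = ~~ [disjoint interferers y i & interferers y j].
Proof.
rewrite -setI_eq0; apply/existsP/set0Pn => -[l].
  by move=> H; exists l; rewrite !inE.
by rewrite !inE => H; exists l.
Qed.

(** Interference is defined by changes of one coordinate, so [z] is turned into [z'] one coordinate
    at a time, by induction on the number of disagreements. Each changed coordinate lies outside
    [interferers y j] and leaves the outcome fixed. *)
Lemma depends_on_interferers y j : depends_on (interferers y j) (y j).
Proof.
move=> z z' zz'; have [N] := ubnP #|[set i | z i != z' i]|.
elim: N z zz' => // N IH z zz' zN.
have [D0|[i]] := set_0Vmem [set i | z i != z' i].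
  suff -> : z = z' by [].
  apply/ffunP => i; apply/eqP; apply: contraT => zi.
  by move/setP: D0 => /(_ i); rewrite !inE zi.
rewrite inE => zi.
pose w : assignment n := [ffun l => if l == i then z' i else z l].
have iS : i \notin interferers y j by apply: contra zi => /zz' ->.
have zw : y j z = y j w.
  move: iS; rewrite inE negb_or => /andP[_]; rewrite negb_exists => /forallP/(_ z).
  rewrite negb_exists => /forallP/(_ w); rewrite negb_and negbK.
  rewrite (@del_eqP i z w) ?eqxx/= => [/eqP//|l li].
  by rewrite ffunE (negbTE li).
rewrite zw; apply: IH => [l lS|].
  by rewrite ffunE; case: eqP => [->//|_]; exact: zz'.
rewrite -ltnS; apply: leq_trans zN.
rewrite ltnS (cardsD1 i [set i | z i != z' i]) inE zi add1n ltnS.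
apply: subset_leq_card; apply/fintype.subsetP => l; rewrite !inE ffunE.
by case: (l =P i) => [->|_]; rewrite ?eqxx.
Qed.

Definition arm_prob P (b : bool) i :=
  if b then prop_score P i else 1 - prop_score P i.

Lemma arm_probE P b i : arm_prob P b i = expect P (fun z => (z i == b)%:R).
Proof.
case: b; rewrite /= /prop_score PrE; first by apply: eq_expect => z; rewrite eqb_id.
rewrite -[X in X - _](expect_cst P) -expectB; apply: eq_expect => z.
by case: (z i); rewrite /= ?subr0 ?subrr.
Qed.

Definition counterfactual y b i (z : assignment n) := y i (ins i b (del i z)).

Definition arm y P (b : bool) (z : assignment n) :=
  n%:R^-1 * \sum_i ((z i == b)%:R * y i z / arm_prob P b i).

Definition arm_mean y P (b : bool) :=
  n%:R^-1 * \sum_i expect P (counterfactual y b i).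

(** Twice a variance plus twice a squared bias. Inverse probabilities are at most [k], whence the
    second moment [k ^+ 2 * K]; the 8 is the 4 of weak dependence times the 2 in [K + 1 * K]. *)
Definition arm_rate (k K D : R) :=
  2 * variance_rate k (k ^+ 2 * K) D + 2 * (8 * k ^+ 2 * K * D) ^+ 2.

Lemma arm_mean_square y P b (k K D : R) : (0 < n)%N -> 0 < k ->
  positivity P k -> weakly_dependent P k ->
  (forall i, expect P (fun z => y i z ^+ 2) <= K) ->
  (forall i, expect P (fun z => `|counterfactual y b i z|) <= K) ->
  \sum_i \sum_j (dependent y i j)%:R <= D * n%:R ->
  expect P (fun z => (arm y P b z - arm_mean y P b) ^+ 2)
    <= arm_rate k K D / n%:R.
Proof.
move=> n0 k0 pos wd yK gK yD.
have nR : 0 < n%:R :> R by rewrite ltr0n.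
have k'0 : 0 < k^-1 by rewrite invr_gt0.
have q_ge i : k^-1 <= arm_prob P b i.
  by have := pos i; rewrite /arm_prob; case: (b); lra.
have q0 i : 0 < arm_prob P b i by apply: lt_le_trans (q_ge i).
have qV i : (arm_prob P b i)^-1 <= k.
  by rewrite -[k]invrK lef_pV2 ?posrE.
pose S := interferers y.
pose X i (z : assignment n) := (z i == b)%:R * y i z / arm_prob P b i.
have SX i : depends_on (S i) (X i).
  move=> z z' zz'; rewrite /X (zz' i (mem_interferers y i)).
  by rewrite (depends_on_interferers zz').
have XK i : expect P (fun z => X i z ^+ 2) <= k ^+ 2 * K.
  apply: le_trans (_ : k ^+ 2 * expect P (fun z => y i z ^+ 2) <= _); last first.
    by rewrite ler_wpM2l ?sqr_ge0.
  rewrite -expectZ; apply: le_expect => z.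
  rewrite /X !exprMn mulrAC ler_wpM2r ?sqr_ge0//.
  rewrite -[leRHS]mul1r; apply: ler_pM; rewrite ?sqr_ge0//.
    by case: (z i == b); rewrite ?expr1n ?expr0n.
  by rewrite lerXn2r ?nnegrE ?invr_ge0 ?(ltW (q0 i)) ?(ltW k0).
have SD : \sum_i \sum_j (~~ [disjoint S i & S j])%:R <= D * n%:R.
  by under eq_bigr do under eq_bigr do rewrite -dependentE.
(* The bias of term [i] is the covariance of the treatment indicator with the counterfactual, over
   the arm probability. The counterfactual ignores coordinate [i], so the two depend on disjoint
   blocks. *)
have bias i : `|expect P (X i) - expect P (counterfactual y b i)| <=
    8 * k ^+ 2 * K / n%:R * #|S i|%:R.
  have XE : expect P (X i) =
      expect P (fun z => (z i == b)%:R * counterfactual y b i z) / arm_prob P b i.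
    rewrite mulrC -expectZ; apply: eq_expect => z; rewrite /X mulrC; congr (_ * _).
    by case: eqP => [<-|]; rewrite ?mul0r// /counterfactual ins_delK.
  have -> : expect P (X i) - expect P (counterfactual y b i) =
      (expect P (fun z => (z i == b)%:R * counterfactual y b i z) -
       expect P (fun z => (z i == b)%:R) * expect P (counterfactual y b i))
      / arm_prob P b i.
    by rewrite XE -arm_probE; field; rewrite gt_eqF.
  rewrite normrM [X in _ * X]ger0_norm ?invr_ge0 ?(ltW (q0 i))//.
  have K0 : 0 <= K by apply: le_trans (gK i); apply: expect_ge0.
  have cov : `|expect P (fun z => (z i == b)%:R * counterfactual y b i z) -
       expect P (fun z => (z i == b)%:R) * expect P (counterfactual y b i)| <=
       4 * k * #|S i|%:R / n%:R * (K + 1 * K).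
    have Si1 : (0 < #|S i|)%N.
      by rewrite card_gt0; apply/set0Pn; exists i; apply: mem_interferers.
    (* The block [S i :\ i] may be empty, so [c] is taken to be [#|S i|], which also dominates the
       size 1 of the other block. *)
    have SiD : (#|S i :\ i| <= #|S i|)%N by rewrite subset_leq_card ?subD1set.
    apply: (covariance_bound n0 k0 wd (A := [set i]) (B := S i :\ i)) => //.
    - by rewrite -setI_eq0; apply/eqP/setP => l; rewrite !inE; case: eqP.
    - by rewrite cards1 ler_nat.
    - by rewrite ler_nat.
    - by rewrite cards1 mul1n ler_nat.
    - by move=> z z' zz'; rewrite zz' ?inE.
    - move=> z z' zz'; rewrite /counterfactual; apply: depends_on_interferers => l lS.
      by rewrite !ins_delE; case: eqP => // /eqP li; apply: zz'; rewrite in_setD1 li.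
    - rewrite -[leRHS](expect_cst P); apply: le_expect => z.
      by case: (z i == b); rewrite ?normr1 ?normr0.
    - apply: le_trans (gK i); apply: le_expect => z; rewrite normrM.
      by case: (z i == b); rewrite ?normr1 ?normr0 ?mul1r ?mul0r.
  apply: le_trans (_ : 4 * k * #|S i|%:R / n%:R * (K + 1 * K) * k <= _).
    by apply: ler_pM; rewrite ?invr_ge0 ?(ltW (q0 i)).
  by rewrite le_eqVlt; apply/orP; left; apply/eqP; ring.
have K0 : 0 <= K by apply: le_trans (gK (Ordinal n0)); apply: expect_ge0.
have sumS : \sum_i #|S i|%:R <= D * n%:R.
  apply: le_trans yD; apply: ler_sum => i _.
  rewrite -sum1_card natr_sum big_mkcond/=; apply: ler_sum => j _.
  case: ifPn => // jS; suff -> : dependent y i j by [].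
  rewrite dependentE -setI_eq0; apply/set0Pn; exists j.
  by apply/setIP; split=> //; apply: mem_interferers.
pose B := n%:R^-1 * (\sum_i expect P (X i)) - arm_mean y P b.
have Bn : `|B| <= 8 * k ^+ 2 * K * D / n%:R.
  rewrite /B /arm_mean -mulrBr -sumrB normrM ger0_norm ?invr_ge0 ?(ltW nR)//.
  rewrite mulrC ler_pdivrMr//; apply: le_trans (ler_norm_sum _ _ _) _.
  apply: le_trans (ler_sum _ (fun i _ => bias i)) _; rewrite -mulr_sumr.
  have -> : 8 * k ^+ 2 * K * D / n%:R * n%:R =
    8 * k ^+ 2 * K / n%:R * (D * n%:R) by field; rewrite gt_eqF.
  by rewrite ler_wpM2l ?divr_ge0 ?mulr_ge0 ?(ltW k0).
(* The squared bias is of order [n^-2], weakened here to the order of the variance. *)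
have B2 : B ^+ 2 <= (8 * k ^+ 2 * K * D) ^+ 2 / n%:R.
  rewrite -[B ^+ 2]real_normK ?num_real//.
  apply: le_trans (_ : (8 * k ^+ 2 * K * D / n%:R) ^+ 2 <= _).
    by rewrite lerXn2r ?nnegrE//; apply: le_trans Bn.
  rewrite exprMn ler_wpM2l ?sqr_ge0// expr2 ler_piMr ?invr_ge0 ?(ltW nR)//.
  by rewrite invf_le1// ler1n.
have -> : expect P (fun z => (arm y P b z - arm_mean y P b) ^+ 2) =
  expect P (fun z => ((n%:R^-1 * \sum_i X i z - n%:R^-1 * \sum_i expect P (X i)) + B) ^+ 2).
  by apply: eq_expect => z; congr (_ ^+ 2); rewrite /B /arm /X; ring.
apply: le_trans (expect_sqrD _ _ _) _; rewrite expect_cst.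
have -> : arm_rate k K D / n%:R = 2 * (variance_rate k (k ^+ 2 * K) D / n%:R) +
    2 * ((8 * k ^+ 2 * K * D) ^+ 2 / n%:R) by rewrite /arm_rate; ring.
apply: lerD; apply: ler_wpM2l => //.
by have := mean_square_average n0 k0 wd (mem_interferers y) SX XK SD.
Qed.

End Interference.

(** * Orders in probability *)

Section Moments.
Variables (R : realType) (n : nat) (P : design R n).

(** Up to 1 the power is at most 1; beyond 1 it increases with the exponent. This gives low moments
    from high ones without Jensen's inequality. *)
Lemma le1D_powR (x p : R) (j : nat) : 0 <= x -> j%:R <= p -> x ^+ j <= 1 + x `^ p.
Proof.
move=> x0 jp; have [x1|x1] := leP x 1.
  by apply: (@le_trans _ _ 1); rewrite ?exprn_ile1// lerDl powR_ge0.
rewrite -powR_mulrn//; apply: (@le_trans _ _ (x `^ p)); last by rewrite lerDr.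
by rewrite ler_powR// ltW.
Qed.

Lemma expect_moment (f : assignment n -> R) (k p : R) (j : nat) : j%:R <= p ->
  expect P (fun z => `|f z| `^ p) <= k `^ p ->
  expect P (fun z => `|f z| ^+ j) <= 1 + k `^ p.
Proof.
move=> jp fk; apply: le_trans (_ : expect P (fun z => 1 + `|f z| `^ p) <= _).
  by apply: le_expect => z; exact: le1D_powR.
by rewrite expectD expect_cst lerD2l.
Qed.

End Moments.

Local Open Scope classical_set_scope.

Section BigOp.
Variables (R : realType) (P : forall n, design R n).
Implicit Types (X Y U V : forall n, assignment n -> R) (a : nat -> R).

Definition root_rate : nat -> R := fun n => n%:R `^ (- 2^-1).

Lemma root_rate_gt0 n : (0 < n)%N -> 0 < root_rate n.
Proof. by move=> n0; rewrite powR_gt0// ltr0n. Qed.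

Lemma root_rate_sqr n : (0 < n)%N -> root_rate n ^+ 2 = n%:R^-1.
Proof.
move=> n0; rewrite expr2 -powRD ?pnatr_eq0 -?lt0n ?n0 ?implybT//.
have -> : - 2^-1 + - 2^-1 = -1 :> R by lra.
by rewrite powR_inv1.
Qed.

Lemma bigOp_eq X Y a : (\forall n \near \oo, X n =1 Y n) ->
  bigOp P X a -> bigOp P Y a.
Proof.
move=> XY Xa eps eps0; have [M HM] := Xa _ eps0; exists M.
near=> n; apply: le_trans (_ : Pr (P n) (fun z => M * a n < `|X n z|) <= _).
  apply: le_Pr => z; have XYn : X n =1 Y n by near: n.
  by rewrite XYn.
by near: n.
Unshelve. all: by end_near. Qed.

Lemma bigOpB X Y a : bigOp P X a -> bigOp P Y a ->
  bigOp P (fun n z => X n z - Y n z) a.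
Proof.
move=> Xa Ya eps eps0; have e2 : 0 < eps / 2 by rewrite divr_gt0.
have [M HM] := Xa _ e2; have [N HN] := Ya _ e2; exists (M + N).
near=> n.
apply: le_trans (_ : Pr (P n) (fun z => (M * a n < `|X n z|) || (N * a n < `|Y n z|)) <= _).
  apply: le_Pr => z; rewrite mulrDl => H; rewrite -[_ || _]negbK negb_or -!leNgt.
  apply/negP => /andP[h1 h2]; move: H; apply/negP; rewrite -leNgt.
  exact: le_trans (ler_normB _ _) (lerD h1 h2).
apply: le_trans (le_PrU _ _ _) _; rewrite [leRHS]splitr; apply: lerD; near: n => //.
Unshelve. all: by end_near. Qed.

(** Where [|V - 1| <= 1/2], the identity [U / V - mu = ((U - mu) - mu * (V - 1)) / V] bounds the
    error by [2 * |U - mu| + 2 * K * |V - 1|]. Chebyshev's inequality handles this bound and the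
    exceptional event. *)
Lemma bigOp_ratio U V (mu : nat -> R) (C K : R) :
  (\forall n \near \oo,
     [/\ expect (P n) (fun z => (U n z - mu n) ^+ 2) <= C / n%:R,
         expect (P n) (fun z => (V n z - 1) ^+ 2) <= C / n%:R
       & `|mu n| <= K]) ->
  bigOp P (fun n z => U n z / V n z - mu n) root_rate.
Proof.
move=> H eps eps0; pose T := `|8 * (1 + K ^+ 2) * C|.
(* [T / n] bounds the second moment of [W] below, and [M] is chosen so that [M >= 1] and
   [2 * T <= eps * M], hence [T / M ^+ 2 <= eps / 2]. *)
pose M := 1 + 2 * T / eps.
have T0 : 0 <= T by apply: normr_ge0.
have M1 : 1 <= M by rewrite lerDl divr_ge0 ?mulr_ge0 ?(ltW eps0).
have TM : T / M ^+ 2 <= eps / 2.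
  have : 2 * T <= eps * M.
    by rewrite mulrDr mulr1 mulrCA divff ?gt_eqF// mulr1 lerDr ltW.
  by rewrite ler_pdivrMr ?exprn_gt0 ?(lt_le_trans ltr01)// expr2; nra.
exists M; near=> n.
have n0 : (0 < n)%N by near: n; exact: nbhs_infty_gt.
have nR : 0 < n%:R :> R by rewrite ltr0n.
have [UC VC muK] : [/\ expect (P n) (fun z => (U n z - mu n) ^+ 2) <= C / n%:R,
         expect (P n) (fun z => (V n z - 1) ^+ 2) <= C / n%:R
       & `|mu n| <= K] by near: n.
(* Makes the bound [4 * C / n] on the probability of the exceptional event at most [eps / 2]. *)
have Cn : 8 * C / eps <= n%:R by near: n; exact: nbhs_infty_ger.
pose W z := 2 * `|U n z - mu n| + 2 * K * `|V n z - 1|.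
have a0 := root_rate_gt0 n0.
apply: le_trans (_ : Pr (P n) (fun z => (M * root_rate n < `|W z|) ||
    (2^-1 < `|V n z - 1|)) <= _).
  apply: le_Pr => z H'; rewrite -[_ || _]negbK negb_or -!leNgt.
  apply/negP => /andP[h1 h2]; move: H'; apply/negP; rewrite -leNgt.
  apply: le_trans h1; apply: le_trans (ler_norm _).
  have V2 : 2^-1 <= V n z by move: h2; rewrite ler_norml => /andP[]; lra.
  have V0 : 0 < V n z by lra.
  have -> : U n z / V n z - mu n =
      ((U n z - mu n) - mu n * (V n z - 1)) / V n z by field; rewrite gt_eqF.
  rewrite normrM [X in _ * X]gtr0_norm ?invr_gt0// ler_pdivrMr//.
  apply: le_trans (ler_normB _ _) _; rewrite normrM /W.
  have u0 := normr_ge0 (U n z - mu n); have v0 := normr_ge0 (V n z - 1).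
  have := ler_wpM2r v0 muK.
  have K0 : 0 <= K * `|V n z - 1| by rewrite mulr_ge0//; apply: le_trans muK.
  move: (`|U n z - _|) (`|mu n| * _) u0 => x x' u0 h.
  have : 0 <= (K * `|V n z - 1|) * (V n z - 2^-1) by rewrite mulr_ge0// subr_ge0.
  have : 0 <= x * (V n z - 2^-1) by rewrite mulr_ge0// subr_ge0.
  nra.
apply: le_trans (le_PrU _ _ _) _; rewrite [leRHS]splitr; apply: lerD.
  apply: le_trans (chebyshev _ _ _) _; first by rewrite mulr_gt0// (lt_le_trans ltr01).
  apply: le_trans TM; rewrite exprMn root_rate_sqr// invfM mulrA invrK mulrAC.
  rewrite ler_wpM2r ?invr_ge0 ?sqr_ge0// -ler_pdivlMr//.
  apply: le_trans (_ : 8 * (1 + K ^+ 2) * C / n%:R <= _); last first.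
    by rewrite ler_wpM2r ?invr_ge0 ?ler_norm// ltW.
  apply: le_trans (expect_sqrD _ _ _) _.
  have -> : expect (P n) (fun z => (2 * `|U n z - mu n|) ^+ 2) =
      4 * expect (P n) (fun z => (U n z - mu n) ^+ 2).
    rewrite -expectZ; apply: eq_expect => z.
    by rewrite exprMn real_normK ?num_real//; ring.
  have -> : expect (P n) (fun z => (2 * K * `|V n z - 1|) ^+ 2) =
      4 * K ^+ 2 * expect (P n) (fun z => (V n z - 1) ^+ 2).
    rewrite -expectZ; apply: eq_expect => z.
    by rewrite exprMn real_normK ?num_real//; ring.
  have := ler_wpM2l (sqr_ge0 K) VC.
  by rewrite -!mulrA; nra.
apply: le_trans (chebyshev _ _ _) _; first by rewrite invr_gt0.
rewrite exprVn invrK; apply: le_trans (_ : C / n%:R * 2 ^+ 2 <= _).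
  by rewrite ler_wpM2r.
move: Cn; rewrite ler_pdivrMr// => Cn.
by rewrite mulrAC ler_pdivrMr//; nra.
Unshelve. all: by end_near. Qed.

Lemma bigOp_mean_square U (mu : nat -> R) (C K : R) :
  (\forall n \near \oo,
     expect (P n) (fun z => (U n z - mu n) ^+ 2) <= C / n%:R) ->
  (\forall n \near \oo, `|mu n| <= K) ->
  bigOp P (fun n z => U n z - mu n) root_rate.
Proof.
move=> UC muK.
apply: (@bigOp_eq (fun n z => U n z / 1 - mu n)).
  by apply: nearW => n z; rewrite divr1.
apply: (@bigOp_ratio U (fun n z => 1) mu `|C| K).
near=> n; split.
- apply: le_trans (_ : C / n%:R <= _); last by rewrite ler_wpM2r ?ler_norm.
  by near: n.
- by rewrite subrr expr0n/= expect_cst mulr_ge0.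
- by near: n.
Unshelve. all: by end_near. Qed.

End BigOp.

(** * The estimators *)

Section Estimators.
Variables (R : realType) (n : nat).
Implicit Types (y : outcomes R n) (P : design R n).

Lemma tau_HTE y P z : tau_HT y P z = arm y P true z - arm y P false z.
Proof.
rewrite /tau_HT /arm; congr (_ * _ - _ * _); apply: eq_bigr => i _.
  by rewrite eqb_id.
by case: (z i); rewrite ?subrr ?subr0.
Qed.

Lemma tau_EATEE y P : tau_EATE y P = arm_mean y P true - arm_mean y P false.
Proof.
rewrite /tau_EATE /arm_mean -mulrBr -sumrB; congr (_ * _).
by apply: eq_bigr => i _; rewrite expectB.
Qed.

Definition unit_outcomes : outcomes R n := fun _ _ => 1.

Lemma tau_HAE y P z : (0 < n)%N ->
  tau_HA y P z = arm y P true z / arm unit_outcomes P true z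
    - arm y P false z / arm unit_outcomes P false z.
Proof.
move=> n0; have nR : n%:R != 0 :> R by rewrite pnatr_eq0 -lt0n.
rewrite /tau_HA /arm /unit_outcomes.
(* Also valid at [t = 0], where both sides are 0, so an empty arm needs no separate case. *)
have cancel (s t : R) : s / t = (n%:R^-1 * s) / (n%:R^-1 * t).
  by rewrite invfM invrK mulrACA mulVf// mul1r.
rewrite cancel [X in _ - X = _]cancel.
congr (_ * _ / (_ * _) - _ * _ / (_ * _)); apply: eq_bigr => i _;
  by case: (z i); rewrite /= ?mulr1 ?mulr0 ?subrr ?subr0.
Qed.

Lemma arm_mean_unit P b : (0 < n)%N -> arm_mean unit_outcomes P b = 1.
Proof.
move=> n0; rewrite /arm_mean /counterfactual /unit_outcomes.
under eq_bigr do rewrite expect_cst.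
by rewrite sumr_const card_ord mulVf// pnatr_eq0 -lt0n.
Qed.

(** A constant outcome is affected by no other unit, so each unit is dependent on itself alone. *)
Lemma sum_dependent_unit :
  \sum_i \sum_j (dependent unit_outcomes i j)%:R = n%:R :> R.
Proof.
have unitE i j : interferes unit_outcomes i j = (i == j).
  rewrite /interferes; case: eqP => //= _; apply/negbTE.
  rewrite negb_exists; apply/forallP => z; rewrite negb_exists.
  by apply/forallP => z'; rewrite eqxx andbF.
rewrite -[in RHS](card_ord n) -sumr_const; apply: eq_bigr => i _.
rewrite (bigD1 i)//= big1 ?addr0 => [|j ji].
  suff -> : dependent unit_outcomes i i by [].
  by apply/existsP; exists i; rewrite unitE eqxx.
suff /negbTE -> : ~~ dependent unit_outcomes i j by [].
rewrite negb_exists; apply/forallP => l; rewrite !unitE.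
by case: eqP => [->|]//=; rewrite eq_sym.
Qed.

End Estimators.

(** * Root-n consistency of both estimators *)

Theorem corollary1 (R : realType) (n0 : nat)
    (y : forall n : nat, outcomes R n) (P : forall n : nat, design R n)
    (hdesign :
      (forall n, (n0 <= n)%N -> bernoulli_design (P n)) \/
      (exists p : R, 0 < p < 1 /\
         forall n, (n0 <= n)%N -> complete_design p (P n)))
    (hreg : regularity_conditions n0 y P)
    (hdavg : (fun n => davg (y n)) =O_\oo (fun=> 1 : R)) :
  bigOp P (fun n z => tau_HT (y n) (P n) z - tau_EATE (y n) (P n))
    (fun n => n%:R `^ (- 2^-1))
  /\
  bigOp P (fun n z => tau_HA (y n) (P n) z - tau_EATE (y n) (P n))
    (fun n => n%:R `^ (- 2^-1)).
Proof.
have [k [q [s [k0 q2 s1 reg]]]] := hreg.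
have /eqO_exP[D0 _ HD0] := hdavg.
(* Both constants are at least 1, so that they also serve for the constant outcome 1 in the Hájek
   denominators. *)
pose D := 1 + `|D0|; pose K : R := 1 + (k `^ q + k `^ s).
have D1 : 1 <= D by rewrite lerDl.
have K1 : 1 <= K by rewrite lerDl addr_ge0 ?powR_ge0.
pose C := arm_rate k K D.
have rates b : \forall n \near \oo,
    [/\ expect (P n) (fun z => (arm (y n) (P n) b z - arm_mean (y n) (P n) b) ^+ 2)
          <= C / n%:R,
        expect (P n) (fun z => (arm (@unit_outcomes R n) (P n) b z - 1) ^+ 2)
          <= C / n%:R
      & `|arm_mean (y n) (P n) b| <= K].
  near=> n.
  have n_gt0 : (0 < n)%N by near: n; exact: nbhs_infty_gt.
  have n0n : (n0 <= n)%N by near: n; exact: nbhs_infty_ge.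
  have nR : 0 < n%:R :> R by rewrite ltr0n.
  have pos : positivity (P n) k by move=> i; have [] := reg n n0n i.
  have k1 : 1 <= k.
    (* Positivity at any single unit forces [k^-1 <= 1 - k^-1]. *)
    have k20 : k^-1 <= 2^-1 by have := pos (Ordinal n_gt0); lra.
    have : 2 <= k by rewrite -[k]invrK -[2]invrK lef_pV2 ?posrE ?invr_gt0.
    lra.
  have wd : weakly_dependent (P n) k.
    case: hdesign => [bern|[p [_ comp]]].
      exact: bernoulli_weakly_dependent k0 (bern n n0n).
    by apply: (complete_weakly_dependent _ k1 pos (comp n n0n)). 
  have yK i : expect (P n) (fun z => y n i z ^+ 2) <= K.
    have [_ yq _] := reg n n0n i.
    apply: le_trans (_ : 1 + k `^ q <= _); last by rewrite /K lerD2l lerDl powR_ge0.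
    apply: le_trans (expect_moment (j := 2) q2 yq); apply: le_expect => z.
    by rewrite real_normK ?num_real.
  have gK b' i : expect (P n) (fun z => `|counterfactual (y n) b' i z|) <= K.
    have [_ _ /(_ b') ys] := reg n n0n i.
    apply: le_trans (_ : 1 + k `^ s <= _); last by rewrite /K lerD2l lerDr powR_ge0.
    exact: (expect_moment (j := 1) s1 ys).
  have yD : \sum_i \sum_j (dependent (y n) i j)%:R <= D * n%:R.
    have : `|davg (y n)| <= D0 * `|1 : R| by near: n.
    rewrite normr1 mulr1 => davg_le.
    rewrite -ler_pdivrMr// mulrC; apply: le_trans (ler_norm _) _.
    apply: le_trans davg_le _; apply: le_trans (ler_norm _) _.
    by rewrite /D lerDr.
  split.
  - exact: arm_mean_square.
  - have := @arm_mean_square R n (@unit_outcomes R n) (P n) b k K D n_gt0 k0 pos wd.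
    rewrite arm_mean_unit//; apply.
    + move=> i; rewrite -(expect_cst (P n) K).
      by apply: le_expect => z; rewrite /unit_outcomes expr1n.
    + move=> i; rewrite -(expect_cst (P n) K).
      by apply: le_expect => z; rewrite /counterfactual /unit_outcomes normr1.
    + by rewrite sum_dependent_unit ler_peMl// ltW.
  - rewrite /arm_mean normrM ger0_norm ?invr_ge0// ler_pdivrMl//.
    apply: le_trans (ler_norm_sum _ _ _) _.
    apply: le_trans (_ : \sum_(i < n) K <= _); last first.
      by rewrite sumr_const card_ord mulr_natl.
    by apply: ler_sum => i _; apply: le_trans (expect_norm _ _) _; exact: gK.
split.
- apply: (@bigOp_eq _ _ (fun n z =>
    (arm (y n) (P n) true z - arm_mean (y n) (P n) true) -
    (arm (y n) (P n) false z - arm_mean (y n) (P n) false))).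
    by apply: nearW => n z; rewrite tau_HTE tau_EATEE; ring.
  have arms b := @bigOp_mean_square _ P (fun n => arm (y n) (P n) b)
    (fun n => arm_mean (y n) (P n) b) C K.
  by apply: bigOpB; apply: arms;
    [apply: filterS (rates true)|apply: filterS (rates true)
    |apply: filterS (rates false)|apply: filterS (rates false)] => n [].
- apply: (@bigOp_eq _ _ (fun n z =>
    (arm (y n) (P n) true z / arm (@unit_outcomes R n) (P n) true z
       - arm_mean (y n) (P n) true) -
    (arm (y n) (P n) false z / arm (@unit_outcomes R n) (P n) false z
       - arm_mean (y n) (P n) false))).
    (* Normalizing both sums by [n] requires [n > 0], so the decomposition into arms holds only
       eventually. *)
    near=> n => z; rewrite tau_HAE ?tau_EATEE; first ring.
    by near: n; exact: nbhs_infty_gt.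
  by apply: bigOpB; [exact: bigOp_ratio (rates true)|exact: bigOp_ratio (rates false)].
Unshelve. all: by end_near. Qed.
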